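(* Let $\oplus\subseteq[N]$ be a safe set, let $\ominus\subseteq[N]$ be a pruned set, and let $s\in[N]$. If there exists no $S\in\mathbf{T}(\oplus,\ominus)$ such that $\xi^{(s)}$ is not contained in $\mathrm{conv}(\{\xi^{(\tilde s)} : \tilde s\in S\})$, then $s\in\oplus$, in the sense that $s$ may be added to the safe set: $\oplus\cup\{s\}$ is a safe set.
   Context: Setting. $\xi$ is a random vector in $\mathbb{R}^p$ with finite support $\{\xi^{(1)},\dots,\xi^{(N)}\}$ of cardinality $N$, $[N]=\{1,\dots,N\}$, and $\pi^{(s)}=\mathbb{P}[\xi=\xi^{(s)}]$ for every $s\in[N]$, so that $\sum_{s=1}^N\pi^{(s)}=1$. Let $\mathcal{X}\subseteq\mathbb{R}^d$, let $F$ be a real-valued objective function on $\mathbb{R}^d$, let $c:\mathbb{R}^d\times\mathbb{R}^p\to\mathbb{R}$ be the constraint function, let $\tau\in(0,1)$, and let $M^{(s)}\in\mathbb{R}$ satisfy $M^{(s)}\ge\max_{x\in\mathcal{X}}c(x,\xi^{(s)})$ for each $s\in[N]$. $\mathrm{conv}$ denotes the convex hull. For $S\subseteq[N]$, let $\nu(S)$ be the optimal value of $\min_{x\in\mathcal{X}}F(x)$ subject to $c(x,\xi^{(s)})\le 0$ for all $s\in S$. Infeasible minimization problems have value $+\infty$, unbounded ones $-\infty$. Standing assumptions. (A) For every $s\in[N]$, $\pi^{(s)}>0$ and $\nu(\{s\})>-\infty$. (B) For every $x\in\mathcal{X}$, the function $c(x,\cdot)$ is quasi-convex. Problem (MI-CCP),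 with optimal value $F^*_\tau$: minimize $F(x)$ over $x\in\mathcal{X}$, $z\in\{0,1\}^N$ subject to $\sum_{s=1}^N\pi^{(s)}z_s\ge 1-\tau$ and $c(x,\xi^{(s)})\le M^{(s)}(1-z_s)$ for all $s\in[N]$. Safe set: $\oplus\subseteq[N]$ is a safe set if including the equalities $z_s=1$ for every $s\in\oplus$ in (MI-CCP) does not increase its optimal value $F^*_\tau$. Pruned set: $\ominus\subseteq[N]$ is a pruned set if including the equalities $z_s=0$ for every $s\in\ominus$ in (MI-CCP) does not increase its optimal value $F^*_\tau$. Define $\mathbf{T}(\oplus,\ominus)=\{S\subseteq[N]\setminus\ominus : \oplus\subseteq S \text{ and } \sum_{s\in S}\pi^{(s)}\ge 1-\tau\}$.
   Formalization: The safe set ⊕ and the pruned set ⊖ are additionally assumed joint: imposing z=1 on ⊕ and z=0 on ⊖ together does not increase the optimal value of (MI-CCP); with separate safety and prunedness only, the claim is false. *)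

(* Defs.v *)
From HB Require Import structures.
From mathcomp Require Import all_boot all_order all_algebra.
From mathcomp Require Import all_classical all_reals all_analysis.

Set Implicit Arguments.
Unset Strict Implicit.
Unset Printing Implicit Defensive.

Import Order.TTheory GRing.Theory Num.Theory.
Import numFieldNormedType.Exports.

Local Open Scope classical_set_scope.
Local Open Scope ring_scope.
Local Open Scope convex_scope.

Definition convex_hull (R : realType) (E : lmodType R) (A : set E) : set E :=
  smallest (@convex_set R E) A.

Definition quasi_convex (R : realType) (E : lmodType R) (f : E -> R) : Prop :=
  forall (t : {i01 R}) (x y : convex_lmodType E),
    f (x <| t |> y) <= Num.max (f x) (f y).

Definition random_vector (R : realType) (p : nat) (dO : measure_display)
    (Omega : measurableType dO) (xi : Omega -> 'rV[R]_p) : Prop :=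
  forall j : 'I_p, measurable_fun [set: Omega] (fun w => xi w ord0 j).

(* [prob s] is P[xi = scen s].  Once every [prob s] is positive, the last
   clause says that the support of [xi] is {scen s | s < N}, which has
   cardinality N by injectivity. *)
Definition finitely_supported (R : realType) (p N : nat) (dO : measure_display)
    (Omega : measurableType dO) (P : probability Omega R)
    (xi : Omega -> 'rV[R]_p) (scen : 'I_N -> 'rV[R]_p) (prob : 'I_N -> R)
    : Prop :=
  [/\ injective scen,
      forall s, P (xi @^-1` [set scen s]) = (prob s)%:E &
      P (xi @^-1` range scen) = 1%E].


Section ChanceConstrained.
Context (R : realType) (d p N : nat).
Context (X : set 'rV[R]_d) (F : 'rV[R]_d -> R) (c : 'rV[R]_d -> 'rV[R]_p -> R).
Context (scen : 'I_N -> 'rV[R]_p) (prob : 'I_N -> R) (tau : R) (M : 'I_N -> R).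

(* Optimal value of min F over [feas]: the infimum in the extended reals, hence
   +oo when [feas] is empty and -oo when F is unbounded below on it. *)
Definition opt_value (feas : set 'rV[R]_d) : \bar R :=
  ereal_inf [set (F x)%:E | x in feas].

Definition nu (S : {set 'I_N}) : \bar R :=
  opt_value [set x | X x /\ forall s, s \in S -> c x (scen s) <= 0].

Definition miccp_feasible (x : 'rV[R]_d) (z : {ffun 'I_N -> bool}) : Prop :=
  [/\ X x,
      1 - tau <= \sum_(s < N) prob s * (z s)%:R &
      forall s, c x (scen s) <= M s * (1 - (z s)%:R)].

(* Optimal value of (MI-CCP) with the extra constraint [E] on the binaries. *)
Definition miccp_value_with (E : {ffun 'I_N -> bool} -> Prop) : \bar R :=
  opt_value [set x | exists z, miccp_feasible x z /\ E z].

Definition miccp_value : \bar R := miccp_value_with (fun=> True).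

Definition ones_on (oplus : {set 'I_N}) (z : {ffun 'I_N -> bool}) : Prop :=
  forall s, s \in oplus -> z s = true.

Definition zeros_on (ominus : {set 'I_N}) (z : {ffun 'I_N -> bool}) : Prop :=
  forall s, s \in ominus -> z s = false.

Definition safe_set (oplus : {set 'I_N}) : Prop :=
  (miccp_value_with (ones_on oplus) <= miccp_value)%E.

Definition pruned_set (ominus : {set 'I_N}) : Prop :=
  (miccp_value_with (zeros_on ominus) <= miccp_value)%E.

(* Both groups of equalities may be imposed at the same time.  This does not
   follow from [safe_set oplus] and [pruned_set ominus], since each of those
   may be witnessed by a different optimal solution. *)
Definition jointly_screened (oplus ominus : {set 'I_N}) : Prop :=
  (miccp_value_with (fun z => ones_on oplus z /\ zeros_on ominus z)
     <= miccp_value)%E.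

Definition Tfamily (oplus ominus S : {set 'I_N}) : Prop :=
  [/\ S \subset ~: ominus, oplus \subset S & 1 - tau <= \sum_(s in S) prob s].

Definition standing_A : Prop :=
  forall s, 0 < prob s /\ (-oo < nu [set s]%SET)%E.

Definition standing_B : Prop :=
  forall x, X x -> quasi_convex (c x).

End ChanceConstrained.

(* Main.v *)
Require Import Defs.
From HB Require Import structures.
From mathcomp Require Import all_boot all_order all_algebra.
From mathcomp Require Import all_classical all_reals all_analysis.

Import Order.TTheory GRing.Theory Num.Theory.
Import numFieldNormedType.Exports.

Local Open Scope classical_set_scope.
Local Open Scope ring_scope.

(** The screening test is sound because a scenario lying in the convex hull of
    satisfied scenarios is satisfied for free.  Take [x], [z] feasible for
    (MI-CCP) with the equalities of both the safe and the pruned set imposed,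
    and let [S] be the set of scenarios selected by [z].  Then [S] belongs to
    T, so by hypothesis [scen s] lies in the convex hull of the selected
    scenarios.  Each of these satisfies [c x _ <= 0], and quasi-convexity makes
    the sublevel set [c x _ <= 0] convex, so it contains [scen s] as well
    ([quasi_convex_hull_le]).  Hence [z] can be changed to select [s] without
    touching [x]: the probability mass can only grow
    ([miccp_feasible_select]).  So every decision [x] of the jointly screened
    problem stays admissible when selecting [s] replaces the exclusions, and the
    value of the jointly screened problem is assumed to be at most that of
    (MI-CCP).  The joint assumption matters: separately, the safe and the pruned
    set may be witnessed by different solutions, and T may then miss the [S] of
    every near-optimal [z]. *)

(** The sublevel sets of a quasi-convex function are convex, so they contain the
    hull of any of their subsets. *)
Lemma quasi_convex_hull_le (R : realType) (E : lmodType R) (f : E -> R)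
    (A : set E) (a : R) (y : E) :
  quasi_convex f -> (forall u, A u -> f u <= a) -> convex_hull A y -> f y <= a.
Proof.
move=> qf fA; apply: (smallest_sub (X := [set u | f u <= a])) => //.
move=> u v t; rewrite !inE /= => fu fv.
by apply: le_trans (qf t u v) _; rewrite ge_max fu fv.
Qed.

Lemma opt_value_le (R : realType) (d : nat) (F : 'rV[R]_d -> R)
    (A B : set 'rV[R]_d) :
  A `<=` B -> (opt_value F B <= opt_value F A)%E.
Proof. by move=> AB; apply/ereal_inf_le_tmp/image_subset. Qed.

Definition selected {N : nat} (z : {ffun 'I_N -> bool}) : {set 'I_N} :=
  [set t | z t]%SET.

Definition select {N : nat} (s : 'I_N) (z : {ffun 'I_N -> bool}) :
    {ffun 'I_N -> bool} :=
  [ffun t => (t == s) || z t].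

Section Screening.
Context {R : realType} {d p N : nat}.
Context {X : set 'rV[R]_d} {c : 'rV[R]_d -> 'rV[R]_p -> R}.
Context {scen : 'I_N -> 'rV[R]_p} {prob : 'I_N -> R} {tau : R} {M : 'I_N -> R}.
Implicit Types (x : 'rV[R]_d) (z : {ffun 'I_N -> bool}) (s : 'I_N).

(** Where [z] is one the big-M term vanishes, and the original constraint is
    enforced. *)
Lemma miccp_feasible_le0 x z s :
  miccp_feasible X c scen prob tau M x z -> z s -> c x (scen s) <= 0.
Proof. by case=> _ _ /(_ s) + zs; rewrite zs subrr mulr0. Qed.

Lemma miccp_feasible_Tfamily (oplus ominus : {set 'I_N}) x z :
  miccp_feasible X c scen prob tau M x z ->
  ones_on oplus z -> zeros_on ominus z ->
  Tfamily prob tau oplus ominus (selected z).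
Proof.
move=> [_ mass _] z1 z0; split.
- by apply/fintype.subsetP => t; rewrite !inE => zt; apply/negP => /z0; rewrite zt.
- by apply/fintype.subsetP => t /z1 zt; rewrite inE zt.
- apply: le_trans mass _; rewrite [leRHS]big_mkcond /=.
  by apply: ler_sum => t _; rewrite inE; case: (z t); rewrite ?mulr1 ?mulr0.
Qed.

Lemma miccp_feasible_select x z s :
  0 <= prob s -> c x (scen s) <= 0 ->
  miccp_feasible X c scen prob tau M x z ->
  miccp_feasible X c scen prob tau M x (select s z).
Proof.
move=> ps cs [Xx mass cM]; split=> // [|t].
- apply: le_trans mass _; apply: ler_sum => t _; rewrite ffunE.
  by case: eqVneq => //= ->; rewrite mulr1; case: (z s); rewrite ?mulr1 ?mulr0.
- by rewrite ffunE; case: eqVneq => //= ->; rewrite subrr mulr0.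
Qed.

End Screening.

Theorem proposition2
  (R : realType) (d p N : nat)
  (dO : measure_display) (Omega : measurableType dO) (P : probability Omega R)
  (xi : Omega -> 'rV[R]_p) (scen : 'I_N -> 'rV[R]_p) (prob : 'I_N -> R)
  (X : set 'rV[R]_d) (F : 'rV[R]_d -> R) (c : 'rV[R]_d -> 'rV[R]_p -> R)
  (tau : R) (M : 'I_N -> R)
  (hxi : random_vector xi)
  (hsupp : finitely_supported P xi scen prob)
  (htau : 0 < tau < 1)
  (hM : forall (s : 'I_N) (x : 'rV[R]_d), X x -> c x (scen s) <= M s)
  (hA : standing_A X F c scen prob)
  (hB : standing_B X c)
  (oplus ominus : {set 'I_N})
  (hsafe : safe_set X F c scen prob tau M oplus)
  (hpruned : pruned_set X F c scen prob tau M ominus)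
  (hjoint : jointly_screened X F c scen prob tau M oplus ominus)
  (s : 'I_N)
  (hs : ~ exists S : {set 'I_N}, Tfamily prob tau oplus ominus S /\
          ~ convex_hull [set scen t | t in [set` S]] (scen s)) :
  safe_set X F c scen prob tau M (oplus :|: [set s])%SET.
Proof.
apply: le_trans hjoint; apply: opt_value_le => x [z [zfeas [z1 z0]]].
have Xx : X x by case: zfeas.
have hull_s : convex_hull [set scen t | t in [set` selected z]] (scen s).
  apply: contrapT => nhull; apply: hs; exists (selected z); split=> //.
  exact: miccp_feasible_Tfamily zfeas z1 z0.
have cs : c x (scen s) <= 0.
  apply: quasi_convex_hull_le (hB _ Xx) _ hull_s => _ [t /= zt <-].
  by apply: miccp_feasible_le0 zfeas _; rewrite inE in zt.
exists (select s z); split.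
  by apply: miccp_feasible_select => //; case: (hA s) => /ltW.
move=> t; rewrite !inE ffunE => /orP[/z1 ->|->] //.
exact: orbT.
Qed.
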